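(* Let $\mathcal I=\{1,\dots,I\}$ be the set of user equipments (UEs), let the active cluster size be $l=1$ (exactly one UE transmits in each slot), and suppose the UEs are homogeneous, i.e. their time-varying packet error rates (PERs) are independent and identically distributed over all UEs and all time slots. Then, among all blind schedules $\pi$, round-robin is: (1) the optimum that minimizes $\frac{1}{I}\sum_{i\in\mathcal I}\mathbb E_\pi\left(h_i(t)\right)$ for all $t\in\mathbb N^+$, if $h_i(0)=h_j(0)$ for all $i,j\in\mathcal I$; and (2) for arbitrary initial ages $h_i(0)$, $i\in\mathcal I$, an asymptotic optimum that minimizes $\overline h_\pi^{(T,I)}$ as $T\to+\infty$, i.e. for every blind schedule $\pi$, $\limsup_{T\to\infty}\overline h_{\mathrm{RR}}^{(T,I)}\le\liminf_{T\to\infty}\overline h_{\pi}^{(T,I)}$.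
   Context: Time is divided into slots $t=1,2,\dots$ of length $n>0$ (measured in symbol lengths). In each slot $t$ a schedule $\pi$ selects an active cluster $\mathcal I_t\subseteq\mathcal I$ with $|\mathcal I_t|=l$; only UEs in $\mathcal I_t$ attempt a transmission. Each UE $i$ scheduled in slot $t$ has a PER $\varepsilon_i(t)\in[0,1]$; these PERs are random, i.i.d. over all $(i,t)$, with mean $\varepsilon_{\mathrm{avg}}$. The success indicator $s_i(t)\in\{0,1\}$ is Bernoulli with success probability $1-\varepsilon_i(t)$ (independently over $(i,t)$ given the PERs). If $i$ is not scheduled in slot $t$, then by convention $\varepsilon_i(t)=1$, so $s_i(t)=0$. Every UE always sends a fresh message when scheduled, so the age of information (AoI) $h_i(t)$ of UE $i$ at the end of slot $t$ evolves, from the initial value $h_i(0)$, as $$h_i(t)=\begin{cases} n & \text{if } s_i(t)=1,\\ h_i(t-1)+n & \text{otherwise.}\end{cases}$$ A schedule is blind if the selection $\mathcal I_t$ in each slot $t$ is a function only of the past selections $\mathcal I_1,\dots,\mathcal I_{t-1}$ and of long-term average channel statistics (the constant $\varepsilon_{\mathrm{avg}}$); in particular it does not depend on the AoI values, on transmission outcomes, or on the realized PERs. Round-robin (RR) is the blind schedule (for $l=1$) that in every slot selects the UE with the longest interval since its last transmission attempt (whether successful or not); UEs that have not yet transmitted are considered to have the longest interval, and ties are broken arbitrarily. $\mathbb E_\pi$ denotes expectation when schedule $\pi$ is used, and $$\overline h_\pi^{(T,I)}=\mathbb E_\pi\left(\frac{1}{IT}\sum_{t=1}^{T}\sum_{i\in\mathcal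 I}h_i(t)\right).$$ *)

(* Defs.v *)
From HB Require Import structures.
From mathcomp Require Import all_boot all_order all_algebra.
From mathcomp Require Import all_classical all_reals all_analysis.

Set Implicit Arguments.
Unset Strict Implicit.
Unset Printing Implicit Defensive.

Import Order.TTheory GRing.Theory Num.Theory.

Local Open Scope classical_set_scope.
Local Open Scope ring_scope.

(* Slots are numbered from 1: the values at index 0 of all the processes below
   are irrelevant, and nothing is assumed about them. *)

Section laws.
Context {d : measure_display} {Omega : measurableType d} {R : realType}.
Variables (P : probability Omega R) (N : nat).

(* All marginal laws equal [law], and the product rule holds over every finite
   set of (UE, slot) pairs. *)
Definition iid_over_slots (law : probability R R)
    (X : 'I_N -> nat -> Omega -> R) : Prop :=
  (forall i t (B : set R), (0 < t)%N -> measurable B ->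
     P (X i t @^-1` B) = law B) /\
  (forall (J : seq ('I_N * nat)) (B : 'I_N * nat -> set R),
     uniq J -> all (fun p => 0 < p.2)%N J -> (forall p, measurable (B p)) ->
     P (\bigcap_(p in [set` J]) (X p.1 p.2 @^-1` B p)) =
     (\prod_(p <- J) P (X p.1 p.2 @^-1` B p))%E).

Definition sigma_of_slots (X : 'I_N -> nat -> Omega -> R) : set_system Omega :=
  <<s [set A | exists i t (B : set R),
         [/\ (0 < t)%N, measurable B & A = X i t @^-1` B]] >>.

(* Given the sigma-algebra of [eps], the [s i t] are independent Bernoulli
   variables with success probabilities [1 - eps i t]: the conditional
   probability of any finite pattern of outcomes is the corresponding product,
   conditional probability being expressed by its defining integral identity. *)
Definition bernoulli_given (eps : 'I_N -> nat -> Omega -> R)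
    (s : 'I_N -> nat -> Omega -> bool) : Prop :=
  forall (A : set Omega) (J : seq ('I_N * nat)) (c : 'I_N * nat -> bool),
    sigma_of_slots eps A -> uniq J -> all (fun p => 0 < p.2)%N J ->
    P (A `&` \bigcap_(p in [set` J]) [set w | s p.1 p.2 w = c p]) =
    (\int[P]_(w in A)
       (\prod_(p <- J)
          (if c p then 1 - eps p.1 p.2 w else eps p.1 p.2 w))%:E)%E.

End laws.

(* [per i t] is the PER that UE [i] sees in slot [t] if it is scheduled there;
   the PER that enters the transmission is [1] for unscheduled UEs. *)
Definition effective_per (R : realType) (N : nat) (Omega : Type)
    (per : 'I_N -> nat -> Omega -> R) (sel : nat -> Omega -> {set 'I_N})
    (i : 'I_N) (t : nat) (w : Omega) : R :=
  if i \in sel t w then per i t w else 1.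

(* The network operated under one schedule, on its own probability space: the
   schedule is the process [sel] of active clusters, and the expectation with
   respect to [sys_P] is the expectation under that schedule. Conditioning on the
   effective PERs presupposes that selections do not react to outcomes; for the
   blind schedules below [sel] is non-random. *)
Record system (R : realType) (N l : nat) (law : probability R R)
    (eps_avg : R) := System {
  sys_disp : measure_display ;
  sys_Omega : measurableType sys_disp ;
  sys_P : probability sys_Omega R ;
  sel : nat -> sys_Omega -> {set 'I_N} ;
  per : 'I_N -> nat -> {RV sys_P >-> R} ;
  succ : 'I_N -> nat -> {RV sys_P >-> bool} ;
  sel_measurable : forall t (C : {set 'I_N}), (0 < t)%N ->
    measurable [set w | sel t w = C] ;
  card_sel : forall t w, (0 < t)%N -> #|sel t w| = l ;
  per01 : forall i t w, (0 < t)%N -> 0 <= per i t w <= 1 ;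
  per_iid : iid_over_slots sys_P law (fun i t => per i t) ;
  per_mean : forall i t, (0 < t)%N -> ('E_sys_P[per i t] = eps_avg%:E)%E ;
  succ_sel : forall i t w, (0 < t)%N -> i \notin sel t w ->
    succ i t w = false ;
  succ_law : bernoulli_given sys_P
    (effective_per (fun i t => per i t) sel) (fun i t => succ i t)
}.

Arguments sel {R N l law eps_avg} s t w.
Arguments per {R N l law eps_avg} s i t.
Arguments succ {R N l law eps_avg} s i t.

Section schedules.
Context {R : realType} {N l : nat} {law : probability R R} {eps_avg : R}.
Implicit Type S : system N l law eps_avg.

Definition blind S : Prop :=
  exists rule : R -> seq {set 'I_N} -> {set 'I_N},
    forall t w, sel S t.+1 w = rule eps_avg [seq sel S u w | u <- iota 1 t].

(* Number of slots from the last attempt of [i] before slot [t] to slot [t].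
   Without any such attempt the maximum is 0 and the value is [t], which
   exceeds the value [t - u] of every UE that attempted in some slot [u >= 1]. *)
Definition idle_time S (i : 'I_N) (t : nat) (w : sys_Omega S) : nat :=
  (t - \max_(1 <= u < t | i \in sel S u w) u)%N.

Fixpoint aoi S (n : R) (h0 : 'I_N -> R) (i : 'I_N) (t : nat)
    (w : sys_Omega S) : R :=
  if t is u.+1 then
    if succ S i t w then n else aoi n h0 i u w + n
  else h0 i.

Definition mean_aoi S (n : R) (h0 : 'I_N -> R) (t : nat) : \bar R :=
  ((N%:R^-1)%:E * \sum_(i < N) 'E_(sys_P S)[aoi n h0 i t])%E.

Definition time_avg_aoi S (n : R) (h0 : 'I_N -> R) (T : nat) : \bar R :=
  ('E_(sys_P S)[fun w => ((N%:R * T%:R)^-1 *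
     \sum_(1 <= t < T.+1) \sum_(i < N) aoi n h0 i t w)%R])%E.

End schedules.

Definition round_robin (R : realType) (N : nat) (law : probability R R)
    (eps_avg : R) (S : system N 1 law eps_avg) : Prop :=
  blind S /\
  forall t w (i j : 'I_N), (0 < t)%N -> i \in sel S t w ->
    (idle_time j t w <= idle_time i t w)%N.

(* Main.v *)
Require Import Defs.
From mathcomp Require Import all_boot all_order all_algebra.
From mathcomp Require Import all_classical all_reals all_analysis.
From mathcomp Require Import measurable_realfun.
From mathcomp Require Import ring lra.
From mathcomp Require Import zify.

(* A blind schedule is non-random, so with [e] the mean PER and [attempts] the number of
   slots of a window in which UE [i] is scheduled, independence gives
     E h_i(t) = h_i(0) * e ^ attempts(1..t) + n * sum_(1 <= a <= t) e ^ attempts(a+1..t).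
   In every window the numbers of attempts sum to the window length, and [m |-> e ^ m] is
   convex, so the sum over the UEs of [e ^ attempts] is least when the numbers of attempts
   differ by at most one, which is exactly what round-robin achieves in all windows at
   once. With equal initial ages this is optimality in every slot. In general, if [e < 1]
   the initial ages have vanishing influence under round-robin, and the remaining part of
   its sum-age is nondecreasing in [t], so its time average converges in the extended
   reals; if [e = 1] all time averages diverge. *)

Set Implicit Arguments.
Unset Strict Implicit.
Unset Printing Implicit Defensive.

Import Order.TTheory GRing.Theory Num.Theory.
Import numFieldNormedType.Exports.
Local Open Scope classical_set_scope.
Local Open Scope ring_scope.

(** * Step-function approximation on the unit interval *)

Section layers.
Variable (R : realType).

(* Lower approximation of [x] in [0, 1] by the [m.+1] equidistant layers. *)
Definition layers (m : nat) (x : R) : R :=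
  \sum_(a < m.+1) m.+1%:R^-1 * (a.+1%:R / m.+1%:R <= x)%R%:R.

(** The sum counts the integers from [1] to [M] that are at most [y], so it is the integer part of
    [y]. *)
Lemma sum_le_indicators (M : nat) (y : R) : 0 <= y <= M%:R ->
  \sum_(a < M) (a.+1%:R <= y)%R%:R <= y <=
  \sum_(a < M) (a.+1%:R <= y)%R%:R + 1.
Proof.
elim: M y => [|M IH] y; first by rewrite big_ord0; lra.
rewrite big_ord_recr/= => /andP[y0 yM].
have [yM1|My] := lerP y M%:R.
  by rewrite [_.+1%:R <= y]leNgt -natr1 (le_lt_trans yM1) ?ltrDl//= addr0 IH ?y0.
have -> : \sum_(a < M) (a.+1%:R <= y)%R%:R = M%:R :> R.
  rewrite (eq_bigr (fun=> 1)) ?sumr_const ?card_ord// => a _.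
  by rewrite (le_trans _ (ltW My))// ler_nat.
by move: yM; rewrite -natr1 => yM; have [h|h] := lerP (M%:R + 1) y;
  rewrite ?mulr1n ?mulr0n; apply/andP; split; lra.
Qed.

Lemma layers_bounds (m : nat) (x : R) : 0 <= x <= 1 ->
  layers m x <= x <= layers m x + m.+1%:R^-1.
Proof.
move=> /andP[x0 x1]; have m0 : 0 < m.+1%:R :> R by [].
have /andP[lb ub] : \sum_(a < m.+1) (a.+1%:R <= x * m.+1%:R)%R%:R
    <= x * m.+1%:R <= \sum_(a < m.+1) (a.+1%:R <= x * m.+1%:R)%R%:R + 1.
  by apply: sum_le_indicators; rewrite mulr_ge0 ?ler_piMl// ltW.
have lE : layers m x = (\sum_(a < m.+1) (a.+1%:R <= x * m.+1%:R)%R%:R) / m.+1%:R.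
  rewrite mulrC mulr_sumr; apply: eq_bigr => a _; by rewrite ler_pdivrMr.
rewrite lE; apply/andP; split; first by rewrite ler_pdivrMr.
by rewrite -[X in _ + X]mul1r -mulrDl ler_pdivlMr.
Qed.

End layers.

(** * Integrals of bounded functions and of products of independent variables *)

Section bounded_measurable.
Context d (T : measurableType d) (R : realType) (P : probability T R).
Implicit Types f g X Z : T -> R.

Definition bounded_measurable f :=
  measurable_fun setT f /\ exists M : R, forall w, `|f w| <= M.

Lemma bounded_measurable_integrable f :
  bounded_measurable f -> P.-integrable setT (EFin \o f).
Proof.
case=> mf [M fM]; apply: measurable_bounded_integrable => //.
  by rewrite (le_lt_trans (probability_le1 _ _)) ?ltry.
by exists M; split; rewrite ?num_real// => x Mx w _ /=; rewrite (le_trans (fM w))// ltW.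
Qed.

Lemma bounded_measurable01 f : measurable_fun setT f ->
  (forall w, 0 <= f w <= 1) -> bounded_measurable f.
Proof.
by move=> mf f01; split=> //; exists 1 => w; have /andP[f0 f1] := f01 w; rewrite ger0_norm.
Qed.

Lemma bounded_measurable_cst r : bounded_measurable (fun=> r).
Proof. by split; [exact: measurable_cst|exists `|r|]. Qed.

Lemma bounded_measurableD f g : bounded_measurable f -> bounded_measurable g ->
  bounded_measurable (fun w => f w + g w).
Proof.
move=> [mf [M fM]] [mg [K gK]]; split; first exact: measurable_funD.
by exists (M + K) => w; rewrite (le_trans (ler_normD _ _))// lerD.
Qed.

Lemma bounded_measurableM f g : bounded_measurable f -> bounded_measurable g ->
  bounded_measurable (fun w => f w * g w).
Proof.
move=> [mf [M fM]] [mg [K gK]]; split; first exact: measurable_funM.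
by exists (M * K) => w; rewrite normrM ler_pM.
Qed.

Lemma bounded_measurable_sum (I : Type) (r : seq I) (F : I -> T -> R) :
  (forall i, bounded_measurable (F i)) ->
  bounded_measurable (fun w => \sum_(i <- r) F i w).
Proof.
move=> bF; elim: r => [|i r IH].
  by under eq_fun do rewrite big_nil; exact: bounded_measurable_cst.
by under eq_fun do rewrite big_cons; exact: bounded_measurableD.
Qed.

Lemma bounded_measurable_prod (I : eqType) (r : seq I) (F : I -> T -> R) :
  (forall i, i \in r -> bounded_measurable (F i)) ->
  bounded_measurable (fun w => \prod_(i <- r) F i w).
Proof.
elim: r => [|i r IH] bF.
  by under eq_fun do rewrite big_nil; exact: bounded_measurable_cst.
under eq_fun do rewrite big_cons.
apply: bounded_measurableM; first by apply: bF; rewrite mem_head.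
by apply: IH => j jr; apply: bF; rewrite inE jr orbT.
Qed.

Lemma bounded_measurable_bool (b : T -> bool) : measurable (b @^-1` [set true]) ->
  bounded_measurable (fun w => (b w)%:R).
Proof.
move=> mb; apply: bounded_measurable01; last by move=> w; case: (b w); rewrite ?lexx ?ler01.
rewrite (_ : (fun=> _) = \1_(b @^-1` [set true])); first exact: measurable_indic.
apply/funext => w; rewrite indicE; congr (nat_of_bool _)%:R.
by apply/idP/idP; rewrite inE.
Qed.

Lemma Rintegral_sum (I : Type) (r : seq I) (F : I -> T -> R) :
  (forall i, bounded_measurable (F i)) ->
  \int[P]_w (\sum_(i <- r) F i w) = \sum_(i <- r) \int[P]_w F i w.
Proof.
move=> bF; elim: r => [|i r IH].
  under eq_Rintegral do rewrite big_nil.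
  by rewrite Rintegral_cst// mul0r big_nil.
under eq_Rintegral do rewrite big_cons.
rewrite RintegralD//; last 2 first.
- exact: bounded_measurable_integrable.
- exact/bounded_measurable_integrable/bounded_measurable_sum.
by rewrite big_cons IH.
Qed.

Lemma Rintegral_bounds f r : bounded_measurable f -> (forall w, 0 <= f w <= r) ->
  0 <= \int[P]_w f w <= r.
Proof.
move=> bf fr; rewrite Rintegral_ge0/=; last by move=> w _; have /andP[] := fr w.
apply: (@le_trans _ _ (\int[P]_w (cst r w))).
  apply: le_Rintegral => //.
  - exact: bounded_measurable_integrable.
  - exact/bounded_measurable_integrable/bounded_measurable_cst.
  - by move=> w _; have /andP[] := fr w.
by rewrite Rintegral_cst// [fine _](congr1 fine (probability_setT P)) mulr1.
Qed.

Lemma bounded_measurable_layers m X : measurable_fun setT X ->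
  bounded_measurable (fun w => layers m (X w)).
Proof.
move=> mX; apply: bounded_measurable_sum => a.
apply: bounded_measurableM; first exact: bounded_measurable_cst.
apply: bounded_measurable_bool.
rewrite (_ : _ @^-1` _ = X @^-1` `[a.+1%:R / m.+1%:R, +oo[).
  by rewrite -[_ @^-1` _]setTI; apply: mX => //; exact: measurable_itv.
by apply/seteqP; split => w /=; rewrite in_itv/= andbT.
Qed.

(** The product rule for threshold events passes by linearity to [layers m] of [X], which
    approximates [X] uniformly. Only [X] is layered, so [Z] can be a product of further
    variables. *)
Lemma Rintegral_mul_of_layers X Z : measurable_fun setT X -> measurable_fun setT Z ->
  (forall w, 0 <= X w <= 1) -> (forall w, 0 <= Z w <= 1) ->
  (forall a, \int[P]_w ((a <= X w)%R%:R * Z w) =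
             \int[P]_w (a <= X w)%R%:R * \int[P]_w Z w) ->
  \int[P]_w (X w * Z w) = \int[P]_w X w * \int[P]_w Z w.
Proof.
move=> mX mZ X01 Z01 ind.
have bX := bounded_measurable01 mX X01; have bZ := bounded_measurable01 mZ Z01.
have intM f g : bounded_measurable f -> bounded_measurable g ->
    P.-integrable setT (EFin \o (fun w => f w * g w)).
  by move=> bf bg; exact/bounded_measurable_integrable/bounded_measurableM.
have bI (a : R) : bounded_measurable (fun w => (a <= X w)%R%:R).
  apply: bounded_measurable_bool; rewrite (_ : _ @^-1` _ = X @^-1` `[a, +oo[).
    by rewrite -[_ @^-1` _]setTI; apply: mX => //; exact: measurable_itv.
  by apply/seteqP; split => w /=; rewrite in_itv/= andbT.
have bL m := bounded_measurable_layers m mX.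
have layersM m : \int[P]_w (layers m (X w) * Z w) =
    \int[P]_w layers m (X w) * \int[P]_w Z w.
  under eq_Rintegral do rewrite mulr_suml.
  rewrite Rintegral_sum => [|a]; last first.
    by do 2?apply: bounded_measurableM => //; exact: bounded_measurable_cst.
  rewrite Rintegral_sum => [|a]; last first.
    by apply: bounded_measurableM => //; exact: bounded_measurable_cst.
  rewrite mulr_suml; apply: eq_bigr => a _.
  under eq_Rintegral do rewrite -mulrA.
  rewrite RintegralZl//; last exact: intM.
  by rewrite ind RintegralZl ?mulrA//; exact: bounded_measurable_integrable.
have bN m : bounded_measurable (fun w => X w - layers m (X w)).
  apply: bounded_measurableD => //.
  rewrite (_ : (fun=> _) = fun w => (-1) * layers m (X w)).
    by apply: bounded_measurableM => //; exact: bounded_measurable_cst.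
  by apply/funext => w; rewrite mulN1r.
have err m w : 0 <= X w - layers m (X w) <= m.+1%:R^-1.
  by have /andP[l0 l1] := layers_bounds m (X01 w); rewrite subr_ge0 l0 lerBlDl.
(* Both sides exceed their common layered counterpart by an amount between [0] and [m.+1%:R^-1], so
   they differ from each other by no more than that. *)
have close m : `|\int[P]_w (X w * Z w) - \int[P]_w X w * \int[P]_w Z w| <= m.+1%:R^-1.
  have e1 : 0 <= \int[P]_w (X w * Z w) - \int[P]_w (layers m (X w) * Z w) <= m.+1%:R^-1.
    rewrite -RintegralB//; [|exact: intM..].
    under eq_Rintegral do rewrite -mulrBl.
    apply: Rintegral_bounds; first exact: bounded_measurableM.
    move=> w; have /andP[e0 e1] := err m w; have /andP[z0 z1] := Z01 w.
    by rewrite mulr_ge0//= (le_trans _ e1)// ler_piMr.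
  have e2 : 0 <= \int[P]_w X w - \int[P]_w layers m (X w) <= m.+1%:R^-1.
    rewrite -RintegralB//; [|exact: bounded_measurable_integrable..].
    exact: Rintegral_bounds.
  have /andP[z0 z1] := Rintegral_bounds bZ Z01.
  have e3 : 0 <= (\int[P]_w X w - \int[P]_w layers m (X w)) * \int[P]_w Z w <= m.+1%:R^-1.
    have /andP[? e2'] := e2.
    by rewrite mulr_ge0//= (le_trans _ e2')// ler_piMr.
  move: e1 e3; rewrite layersM mulrBl.
  move: (_ * _) (_ * _) (\int[P]_w _) (_^-1) => x y z r /andP[? ?] /andP[? ?].
  by rewrite ler_norml; apply/andP; split; lra.
apply/eqP; rewrite -subr_eq0 -normr_le0; apply/ler_addgt0Pl => e e0; rewrite addr0.
(* This choice of [m] makes [m.+1] exceed [e^-1]. *)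
apply: le_trans (close (Num.truncn e^-1)) _.
rewrite invf_ple ?posrE// ltW//; exact: truncnS_gt.
Qed.

(** The factors are replaced one at a time by indicators of half-lines, until only independence of
    events is left to use. The predicate [good] keeps out indices about which nothing is assumed,
    such as slot [0]. *)
Lemma Rintegral_prod_independent (K : choiceType) (good : pred K) (X : K -> T -> R) :
  (forall k, good k -> measurable_fun setT (X k)) ->
  (forall k w, good k -> 0 <= X k w <= 1) ->
  (forall (J : seq K) (B : K -> set R), uniq J -> all good J ->
     (forall k, measurable (B k)) ->
     P (\bigcap_(k in [set` J]) (X k @^-1` B k)) =
     (\prod_(k <- J) P (X k @^-1` B k))%E) ->
  forall J, uniq J -> all good J ->
  \int[P]_w (\prod_(k <- J) X k w) = \prod_(k <- J) \int[P]_w X k w.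
Proof.
move=> mX X01 indep.
have mI k (B : set R) : good k -> measurable B -> measurable (X k @^-1` B).
  by move=> gk mB; rewrite -[_ @^-1` _]setTI; exact: mX.
(* The indicators of the already processed coordinates are carried along, so that the
   layers of the next coordinate can be absorbed into them. *)
suff gen (J2 J1 : seq K) (B : K -> set R) : uniq (J1 ++ J2) -> all good (J1 ++ J2) ->
    (forall k, measurable (B k)) ->
    \int[P]_w (\prod_(k <- J1) \1_(X k @^-1` B k) w * \prod_(k <- J2) X k w) =
    \prod_(k <- J1) fine (P (X k @^-1` B k)) * \prod_(k <- J2) \int[P]_w X k w.
  move=> J uJ gJ; have := gen J [::] (fun=> setT) uJ gJ (fun=> measurableT).
  by under eq_Rintegral do rewrite big_nil mul1r; rewrite big_nil mul1r.
elim: J2 J1 B => [|k J2 IH] J1 B.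
  (* With no factor left, the integrand is the indicator of an intersection, and the claim is the
     hypothesis on events. *)
  rewrite cats0 big_nil => uJ gJ mB.
  under eq_Rintegral do rewrite big_nil mulr1.
  rewrite mulr1 (@eq_Rintegral _ _ _ _ _
    (\1_(\bigcap_(k in [set` J1]) (X k @^-1` B k)))); last first.
    move=> w _; rewrite bigcap_seq indicE; elim: J1 {uJ gJ} => [|k J1 IH].
      by rewrite !big_nil in_setT.
    by rewrite !big_cons IH in_setI -mulnb natrM indicE.
  rewrite /Rintegral integral_indic//; last first.
    by apply: fin_bigcap_measurable => // k /= kJ; apply: mI => //; exact: (allP gJ).
  rewrite setIT [fine _](congr1 fine (indep J1 B uJ gJ mB)); apply: EFin_inj.
  have fin k : k \in J1 -> P (X k @^-1` B k) \is a fin_num.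
    by move=> kJ; apply: fin_num_measure; apply: mI => //; exact: (allP gJ).
  rewrite fineK; last by rewrite big_seq; exact: prode_fin_num.
  by rewrite -prodEFin big_seq [RHS]big_seq; apply: eq_bigr => k kJ; rewrite fineK// fin.
move=> uJ gJ mB.
have [kJ1 uJ12] : k \notin J1 /\ uniq (J1 ++ J2).
  by move: uJ; rewrite -cat1s uniq_catCA cat1s /= mem_cat negb_or => /andP[/andP[]].
have [gk gJ12] : good k /\ all good (J1 ++ J2).
  by move: gJ; rewrite !all_cat/= => /and3P[-> -> ->].
pose Z w := \prod_(j <- J1) \1_(X j @^-1` B j) w * \prod_(j <- J2) X j w.
have EZ : \int[P]_w Z w = _ := IH J1 B uJ12 gJ12 mB.
under eq_Rintegral do rewrite big_cons mulrCA.
rewrite (@Rintegral_mul_of_layers (X k) Z) ?EZ ?big_cons.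
- by rewrite mulrCA.
- exact: mX.
- move: gJ12; rewrite all_cat => /andP[gJ1 gJ2].
  apply: measurable_funM; apply: measurable_prod => j jJ.
  + by apply: measurable_indic; apply: mI => //; exact: (allP gJ1).
  + by apply: mX; exact: (allP gJ2).
- by move=> w; exact: X01.
- move=> w; move: gJ12; rewrite all_cat => /andP[gJ1 gJ2].
  have p01 (s : seq K) (F : K -> R) : (forall j, j \in s -> 0 <= F j <= 1) ->
      0 <= \prod_(j <- s) F j <= 1.
    by move=> F01; rewrite big_seq prodr_ile1// prodr_ge0// => j /F01 /andP[].
  pose I1 j : R := \1_(X j @^-1` B j) w.
  have /andP[a0 a1] : 0 <= \prod_(j <- J1) I1 j <= 1.
    by apply: p01 => j _; rewrite /I1 indicE; case: (_ \in _); rewrite ?lexx ?ler01.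
  have /andP[b0 b1] : 0 <= \prod_(j <- J2) X j w <= 1.
    by apply: p01 => j jJ; apply: X01; exact: (allP gJ2).
  by rewrite mulr_ge0// mulr_ile1.
(* The half-line from [a] becomes the set of coordinate [k], which thereby joins the processed
   indices. The sets over [J1] do not change, as [k] is not in [J1]. *)
move=> a; pose B' j := if j == k then `[a, +oo[%classic else B j.
have B'J1 j : j \in J1 -> B' j = B j.
  by rewrite /B' => jJ1; case: eqP => // jk; rewrite -jk jJ1 in kJ1.
have B'k : B' k = `[a, +oo[%classic by rewrite /B' eqxx.
have layer w : (a <= X k w)%R%:R = \1_(X k @^-1` B' k) w :> R.
  rewrite indicE B'k; congr (nat_of_bool _)%:R.
  by apply/idP/idP; rewrite inE/= in_itv/= andbT.
have IHk := IH (k :: J1) B'; rewrite /= mem_cat negb_or in IHk.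
transitivity (\int[P]_w (\prod_(j <- k :: J1) \1_(X j @^-1` B' j) w *
                         \prod_(j <- J2) X j w)).
  apply: eq_Rintegral => w _; rewrite big_cons layer -mulrA; congr (_ * (_ * _)).
  by apply: eq_big_seq => j jJ1; rewrite B'J1.
rewrite IHk; last 3 first.
- by move: uJ; rewrite -cat1s uniq_catCA cat1s /= mem_cat negb_or.
- by rewrite gk.
- by move=> j; rewrite /B'; case: ifP => // _; exact: measurable_itv.
rewrite big_cons mulrA; congr (_ * _ * _); last first.
  by apply: eq_big_seq => j jJ1; rewrite B'J1.
under [RHS]eq_Rintegral do rewrite layer.
rewrite /Rintegral integral_indic ?setIT//; apply: mI => //.
by rewrite B'k; exact: measurable_itv.
Qed.

End bounded_measurable.

(** * Attempt counts under round-robin *)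

Definition attempts (N : nat) (c : nat -> 'I_N) (i : 'I_N) (a b : nat) : nat :=
  \sum_(a <= u < b) (c u == i).

(** The value [0] stands for no attempt before slot [t], so that a longest idle time is a least
    [last_attempt]. *)
Definition last_attempt (N : nat) (c : nat -> 'I_N) (i : 'I_N) (t : nat) : nat :=
  \max_(1 <= u < t | c u == i) u.

Section round_robin_counts.
Variables (N : nat) (c : nat -> 'I_N).
Local Open Scope nat_scope.

Lemma attempts_cat i a m b : a <= m <= b ->
  attempts c i a b = attempts c i a m + attempts c i m b.
Proof. by case/andP => am mb; rewrite /attempts (big_cat_nat am mb). Qed.

Lemma attempts_recr i a b : a <= b ->
  attempts c i a b.+1 = attempts c i a b + (c b == i).
Proof. by move=> ab; rewrite /attempts big_nat_recr. Qed.

Lemma attempts_eq0 i a b :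
  (forall u, a <= u < b -> c u != i) -> attempts c i a b = 0.
Proof.
by move=> ci; rewrite /attempts big_nat big1// => u /ci /negPf ->.
Qed.

Lemma attempts_gt0 i a b u : a <= u < b -> c u = i -> 0 < attempts c i a b.
Proof.
move=> /andP[au ub] cu; rewrite (@attempts_cat i a u.+1 b); last by lia.
by rewrite attempts_recr// cu eqxx; lia.
Qed.

(** Each slot is counted for exactly one UE. *)
Lemma sum_attempts a b : \sum_(i < N) attempts c i a b = b - a.
Proof.
rewrite exchange_big/= (eq_bigr (fun=> 1)) ?sum_nat_const_nat ?muln1// => u _.
by rewrite (bigD1 (c u))//= eqxx big1// => i /negPf; rewrite eq_sym => ->.
Qed.

Lemma last_attempt_le i t u : 0 < u < t -> c u = i -> u <= last_attempt c i t.
Proof.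
move=> ut cu; rewrite /last_attempt (@leq_bigmax_seq _ _ _ _ u)//; last exact/eqP.
by rewrite mem_index_iota.
Qed.

Lemma last_attemptP i t :
  last_attempt c i t = 0 \/
  (0 < last_attempt c i t < t /\ c (last_attempt c i t) = i).
Proof.
elim: t => [|t IH]; first by left; rewrite /last_attempt big_geq.
case: t => [|t] in IH *; first by left; rewrite /last_attempt big_geq.
rewrite /last_attempt big_mkcond big_nat_recr//= -big_mkcond/= -/(last_attempt c i t.+1).
case: eqP => ct; last first.
  rewrite maxn0; case: IH => [->|[/andP[l0 lt] cl]]; [by left|right].
  by rewrite l0 /=; split=> //; exact: ltnW.
right; rewrite (maxn_idPr _) ?ltnSn//.
by case: IH => [->|[/andP[_ /ltnW]]].
Qed.

Lemma last_attempt_lt i t : 0 < t -> last_attempt c i t < t.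
Proof. by move=> t0; case: (last_attemptP i t) => [->|[/andP[]]]. Qed.

(* Between two consecutive attempts of [i] every other UE makes an attempt. *)
Lemma round_robin_balanced :
  (forall t j, 0 < t -> last_attempt c (c t) t <= last_attempt c j t) ->
  forall a b i j, 0 < a -> attempts c i a b <= (attempts c j a b).+1.
Proof.
move=> rr a b i j a0; elim/ltn_ind: b => -[_|b IH].
  by rewrite /attempts big_geq.
have [ba|ab] := ltnP b a; first by rewrite {1}/attempts big_geq.
have mono x y : a <= x -> x <= y -> attempts c j a x <= attempts c j a y.
  by move=> ax xy; rewrite (@attempts_cat j a x y) ?ax// leq_addr.
rewrite attempts_recr//; have [cb|_] := eqVneq (c b) i; last first.
  by rewrite addn0 (leq_trans (IH _ _))// ltnS mono.
have [->|ij] := eqVneq i j; first by rewrite (attempts_recr j ab); lia.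
have b0 : 0 < b by exact: leq_trans ab.
(* Slot [b] adds an attempt of [i]. As [i] is selected there, its last attempt [u] is no later than
   the last attempt [v] of [j]. *)
set u := last_attempt c i b; set v := last_attempt c j b.
have uv : u <= v by rewrite /u -cb rr.
have ub : u < b by exact: last_attempt_lt.
have after_u x : u < x < b -> c x != i.
  move=> /andP[ux xb]; have x0 : 0 < x by exact: leq_ltn_trans ux.
  apply: contraTneq ux => cx; rewrite -leqNgt.
  by apply: last_attempt_le => //; rewrite x0.
(* If [u < a], the attempt in slot [b] is the only one of [i] in the window. *)
have [ua|au] := ltnP u a.
  by rewrite attempts_eq0// => x /andP[ax xb]; rewrite after_u// (leq_trans ua ax).
(* Here [0 < a <= u <= v], so neither maximum is the default [0]. *)
have [|[/andP[v0 vb] cv]] := last_attemptP j b; rewrite -/v; first by lia.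
have [|[_ cu]] := last_attemptP i b; rewrite -/u; first by lia.
have neq_uv : u != v by apply: contraNneq ij => uv'; rewrite -cu -/u uv' cv.
(* After [u], UE [i] attempts only in slot [b], while [j] attempts at least in slot [v]; the
   induction hypothesis covers the slots up to [u]. *)
rewrite (@attempts_cat i a u.+1 b); last by lia.
rewrite (@attempts_eq0 i u.+1 b)// addn0 addn1 ltnS.
rewrite (@attempts_cat j a u.+1 b.+1); last by lia.
have := IH u.+1 ub; have : 0 < attempts c j u.+1 b.+1.
  by apply: (attempts_gt0 _ cv); lia.
by lia.
Qed.

End round_robin_counts.

(** * Convexity of powers *)

Section convexity.
Variable (R : realType).

(** The left side is the secant through the powers at [q] and [q + 1]. For [q <= k], factoring out
    [e ^+ q] leaves Bernoulli's inequality [above]; for [k < q], factoring out [e ^+ k] leaves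
    [below]. There is no division by [e], so [e = 0] is covered. *)
Lemma exprn_ge_secant (e : R) (q k : nat) : 0 <= e <= 1 ->
  e ^+ q - (1 - e) * e ^+ q * (k%:R - q%:R) <= e ^+ k.
Proof.
move=> /andP[e0 e1].
have below j : e ^+ j * (1 + (1 - e) * j%:R) <= 1.
  elim: j => [|j IH]; first by rewrite expr0; lra.
  apply: le_trans IH; rewrite exprSr -mulrA ler_wpM2l ?exprn_ge0//.
  have j0 : 0 <= j%:R :> R by [].
  have := mulr_ge0 (sqr_ge0 (1 - e)) j0; have := sqr_ge0 (1 - e).
  by rewrite -natr1 !expr2; lra.
have above j : 1 - (1 - e) * j%:R <= e ^+ j.
  elim: j => [|j IH]; first by rewrite expr0; lra.
  have j0 : 0 <= j%:R :> R by [].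
  have := mulr_ge0 (sqr_ge0 (1 - e)) j0; have := ler_wpM2l e0 IH.
  by rewrite !expr2 exprS -natr1; lra.
have [qk|kq] := leqP q k.
  rewrite -(subnKC qk) natrD exprD addrAC subrr add0r.
  apply: le_trans (ler_wpM2l (exprn_ge0 q e0) (above (k - q)%N)); lra.
rewrite -(subnKC (ltnW kq)) natrD exprD opprD addrA subrr add0r.
apply: le_trans (_ : e ^+ k * (e ^+ (q - k) * (1 + (1 - e) * (q - k)%:R)) <= _).
  by lra.
by rewrite ler_piMr ?exprn_ge0.
Qed.

(* The secant of [x |-> e ^ x] over [q, q + 1], [q] being the least value of [m],
   lies below the powers of [e] and interpolates all the [e ^ m i]. *)
Lemma balanced_sum_min (N : nat) (e : R) (m m' : 'I_N -> nat) : 0 <= e <= 1 ->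
  (forall i j, m i <= (m j).+1)%N ->
  (\sum_(i < N) m i = \sum_(i < N) m' i)%N ->
  \sum_(i < N) e ^+ m i <= \sum_(i < N) e ^+ m' i.
Proof.
move=> e01 bal eqs; case: N => [|N] in m m' bal eqs *; first by rewrite !big_ord0.
have [i0 _ min] := @arg_minnP _ (@ord0 N) xpredT m isT.
set q := m i0 in min.
pose f k := e ^+ q - (1 - e) * e ^+ q * (k%:R - q%:R).
(* As [f] is affine, its sum depends only on the total of the exponents. *)
have sf (g : 'I_N.+1 -> nat) : \sum_i f (g i) =
    N.+1%:R * (e ^+ q + (1 - e) * e ^+ q * q%:R)
    - (1 - e) * e ^+ q * (\sum_i g i)%:R.
  rewrite natr_sum mulr_sumr mulr_natl -[in X in X - _](card_ord N.+1) -sumr_const.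
  by rewrite -sumrB; apply: eq_bigr => i _; rewrite /f; ring.
have -> : \sum_i e ^+ m i = \sum_i f (m i).
  apply: eq_bigr => i _; rewrite /f.
  have [->|->] : m i = q \/ m i = q.+1.
    by have := min i isT; have := bal i i0; rewrite -/q; lia.
  - by rewrite subrr; ring.
  - by rewrite exprS -natr1; ring.
rewrite sf eqs -sf; apply: ler_sum => i _; exact: exprn_ge_secant.
Qed.

End convexity.

(** * Mean ages under a deterministic selection *)

Section mean_ages.
Context (R : realType) (N : nat) (e n : R) (h0 : 'I_N -> R).
Implicit Types c : nat -> 'I_N.

(** With [e] the mean PER, summand [a] is the probability that [i] has no success in slots [a + 1]
    to [t]; for [a = t] the window is empty and the summand is [1]. *)
Definition mean_age c (i : 'I_N) (t : nat) : R :=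
  h0 i * e ^+ attempts c i 1 t.+1 +
  n * \sum_(1 <= a < t.+1) e ^+ attempts c i a.+1 t.+1.

Definition initial_age c (t : nat) : R :=
  \sum_(i < N) h0 i * e ^+ attempts c i 1 t.+1.

Definition fresh_age c (t : nat) : R :=
  n * \sum_(1 <= a < t.+1) \sum_(i < N) e ^+ attempts c i a.+1 t.+1.

Lemma sum_mean_age c t :
  \sum_(i < N) mean_age c i t = initial_age c t + fresh_age c t.
Proof. by rewrite big_split/= -mulr_sumr exchange_big. Qed.

(** Windows start at slot [1] or later, as the selection at index [0] is arbitrary. *)
Definition balanced c := forall a b i j, (0 < a)%N ->
  (attempts c i a b <= (attempts c j a b).+1)%N.

Hypothesis e01 : 0 <= e <= 1.
Hypothesis n0 : 0 < n.
Hypothesis h00 : forall i, 0 <= h0 i.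

Let e0 : 0 <= e. Proof. by case/andP: e01. Qed.

(** The windows need only agree in length, since that fixes the total number of attempts. Taking
    [c' = c] compares a window with its shift. *)
Lemma balanced_sum_le c c' a b a' b' : balanced c -> (0 < a)%N ->
  (b - a = b' - a')%N ->
  \sum_(i < N) e ^+ attempts c i a b <= \sum_(i < N) e ^+ attempts c' i a' b'.
Proof.
move=> bal a0 ab; apply: balanced_sum_min => // [i j|]; first exact: bal.
by rewrite !sum_attempts.
Qed.

Lemma initial_age_ge0 c t : 0 <= initial_age c t.
Proof. by apply: sumr_ge0 => i _; rewrite mulr_ge0 ?exprn_ge0. Qed.

Lemma fresh_age_ge0 c t : 0 <= fresh_age c t.
Proof.
rewrite mulr_ge0 ?(ltW n0)//; apply: sumr_ge0 => a _.
by apply: sumr_ge0 => i _; rewrite exprn_ge0.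
Qed.

Lemma fresh_age_le c c' t : balanced c -> fresh_age c t <= fresh_age c' t.
Proof.
by move=> bal; rewrite ler_wpM2l ?(ltW n0)// ler_sum// => a _; exact: balanced_sum_le.
Qed.

(* Shifting a window by one slot does not change its power sum, as both windows are
   balanced; so the sum for [t + 1] is that for [t] plus one nonnegative term. *)
Lemma fresh_age_nondecreasing c t : balanced c -> fresh_age c t <= fresh_age c t.+1.
Proof.
move=> bal; rewrite ler_wpM2l ?(ltW n0)// [leRHS]big_ltn// [X in _ + X]big_add1/=.
rewrite -[leLHS]add0r lerD//; first by apply: sumr_ge0 => i _; rewrite exprn_ge0.
by apply: ler_sum => a _; apply: balanced_sum_le.
Qed.

(** Each of the [N] UEs makes at most one attempt more than [i], and together they make [t]. *)
Lemma attempts_unbounded c i t : balanced c ->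
  (t <= N * (attempts c i 1 t.+1).+1)%N.
Proof.
move=> bal; rewrite -[t in leqLHS](subn1 t.+1) -(sum_attempts c 1 t.+1).
apply: (@leq_trans (\sum_(j < N) (attempts c i 1 t.+1).+1)%N); last first.
  by rewrite sum_nat_const card_ord.
by apply: leq_sum => j _; exact: bal.
Qed.

Lemma initial_age_cvg0 c : balanced c -> e < 1 -> initial_age c @ \oo --> (0 : R).
Proof.
move=> bal e1; suff : initial_age c @ \oo --> \sum_(i < N) h0 i * 0.
  by rewrite big1// => i _; rewrite mulr0.
apply: cvg_big => [|i _]; first exact: add_continuous.
apply: cvgMr; apply/cvgrPdist_lt => r r0.
have /cvgrPdist_lt/(_ r r0)[K _ eK] : GRing.exp e @ \oo --> (0 : R).
  by apply: cvg_expr; rewrite ger0_norm.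
(* From this slot on, [attempts_unbounded] guarantees at least [K] attempts of [i]. *)
exists (N * K.+1)%N => // t /= tK; apply: eK => /=.
have := leq_trans tK (attempts_unbounded i t bal).
by rewrite leq_pmul2l// (leq_ltn_trans _ (ltn_ord i)).
Qed.

End mean_ages.

(** * Time averages and their limits *)

Section averages.
Variable R : realType.
Implicit Type f : nat -> R.

Definition time_average f (T : nat) : R := T%:R^-1 * \sum_(1 <= t < T.+1) f t.

Lemma time_averageD f g T :
  time_average (fun t => f t + g t) T = time_average f T + time_average g T.
Proof. by rewrite /time_average big_split/= mulrDr. Qed.

Lemma time_average_le f g T : (forall t, f t <= g t) ->
  time_average f T <= time_average g T.
Proof. by move=> fg; rewrite ler_wpM2l ?invr_ge0// ler_sum. Qed.

(** A new term that is at least every earlier one cannot lower the average. Nonnegativity serves the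
    step from [T = 0], where [0^-1 = 0] makes the average [0]. *)
Lemma time_average_nondecreasing f : (forall t, 0 <= f t) ->
  (forall t, f t <= f t.+1) -> nondecreasing_seq (time_average f).
Proof.
move=> f0 fS; apply/nondecreasing_seqP => -[|T].
  by rewrite /time_average invr0 mul0r mulr_ge0// sumr_ge0.
have fle t : (t <= T.+1)%N -> f t <= f T.+2.
  move=> tT; have /nondecreasing_seqP -> // : forall t, f t <= f t.+1 by [].
  exact: leqW.
rewrite /time_average [in leRHS]big_nat_recr//=.
set s := \sum_(1 <= t < T.+2) f t.
have sT : s <= T.+1%:R * f T.+2.
  rewrite /s mulr_natl -[T.+1 in leRHS](subn1 T.+2) -sumr_const_nat.
  by rewrite big_nat [leRHS]big_nat ler_sum// => t /andP[_]; exact: fle.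
rewrite ler_pdivrMl// mulrCA ler_pdivlMl// mulrDr -[T.+2%:R]natr1 mulrDl mul1r.
by rewrite lerD2l.
Qed.

(** Cesàro's theorem, applied to the shifted sequence because averaging starts at slot [1]. *)
Lemma time_average_cvg f (l : R) : f @ \oo --> l -> time_average f @ \oo --> l.
Proof.
move=> fl; rewrite -cvg_shiftS.
have /cesaro : (fun t => f t.+1) @ \oo --> l by rewrite (cvg_shiftS f).
rewrite (_ : arithmetic_mean _ = [sequence time_average f T.+1]_T)//.
by apply/funext => T; rewrite /arithmetic_mean /time_average /series/= [in RHS]big_add1.
Qed.

Lemma time_average_id_ge (T : nat) :
  T%:R / 2 <= time_average (fun t => t%:R) T.
Proof.
case: T => [|T]; first by rewrite /time_average invr0 !mul0r.
rewrite ler_pdivlMl//; elim: T => [|T IH]; first by rewrite big_nat1; lra.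
rewrite big_nat_recr//=; move: IH; rewrite -[T.+2%:R]natr1.
have : 0 <= T.+1%:R :> R by [].
by move: (T.+1%:R) (\sum_(_ <= _ < _) _) => x y; nra.
Qed.

End averages.

Lemma le_limn_einf (R : realType) (u v : nat -> \bar R) :
  (forall k, u k <= v k)%E -> (limn_einf u <= limn_einf v)%E.
Proof.
move=> uv; rewrite !limn_einf_lim; apply: lee_lim; [exact: is_cvg_einfs..|].
apply: nearW => m; apply: le_ereal_inf_tmp => _ [k /= mk <-].
by apply: le_trans (uv k); apply: ereal_inf_lbound; exists k.
Qed.

(** * Blind systems and their expected ages *)

Section blind_systems.
Context (R : realType) (N : nat) (law : probability R R) (eps_avg : R).
Variable S : system N 1 law eps_avg.

(** An empty space would have mass [0]. A sample point is needed to read off the values of a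
    non-random selection. *)
Lemma sys_Omega_inhabited : exists w : sys_Omega S, True.
Proof.
apply: contrapT => noS; have := @probability_setT _ _ _ (sys_P S).
rewrite (_ : setT = set0) ?measure0; last by apply/seteqP; split=> w //; case: noS; exists w.
by move/eqP; rewrite eq_sym onee_eq0.
Qed.

(** By strong induction on the slot, the rule is fed with past selections that are already constant;
    cluster size [1] makes each selection a singleton. *)
Lemma blind_selection : blind S ->
  exists c : nat -> 'I_N, forall t w, sel S t.+1 w = [set c t.+1]%SET.
Proof.
case=> rule hrule; have [w0 _] := sys_Omega_inhabited.
have selE t w : sel S t.+1 w = sel S t.+1 w0.
  elim/ltn_ind: t => t IH; rewrite !hrule; congr (rule _ _).
  apply/eq_in_map => -[|u]; rewrite mem_iota// => /andP[_ ut]; exact: IH.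
have /choice[c hc] t : exists x, sel S t.+1 w0 = [set x]%SET.
  by apply/cards1P; rewrite (card_sel w0).
(* The chosen [c t] belongs to slot [t.+1], hence the shift. *)
by exists (c \o predn) => t w; rewrite selE hc.
Qed.

Variable c : nat -> 'I_N.
Hypothesis selc : forall t w, sel S t.+1 w = [set c t.+1]%SET.
Let P := sys_P S.

Lemma per_meanE i t : (0 < t)%N -> \int[P]_w per S i t w = eps_avg.
Proof.
by move=> t0; rewrite /Rintegral; have := per_mean S i t0; rewrite unlock => ->.
Qed.

Lemma eps_avg01 : 0 <= eps_avg <= 1.
Proof.
rewrite -(per_meanE (c 1) (ltn0Sn 0)); apply: Rintegral_bounds.
  by apply: bounded_measurable01 => // w; exact: per01.
by move=> w; exact: per01.
Qed.

Definition failure (i : 'I_N) (u : nat) (w : sys_Omega S) : R := (~~ succ S i u w)%:R.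

Lemma failure_preimage i u :
  (fun w => ~~ succ S i u w) @^-1` [set true] = succ S i u @^-1` [set false].
Proof. by apply/seteqP; split=> w /=; case: (succ S i u w). Qed.

Lemma measurable_failure i u : measurable (succ S i u @^-1` [set false]).
Proof. by rewrite -[_ @^-1` _]setTI; exact: measurable_funPT. Qed.

Lemma bounded_measurable_failure i u : bounded_measurable (failure i u).
Proof.
by apply: bounded_measurable_bool; rewrite failure_preimage; exact: measurable_failure.
Qed.

(** The conditional law of the outcomes turns the probability of joint failure into the integral of
    a product of effective PERs, which factorizes by independence. *)
Lemma Rintegral_failures i (U : seq nat) : uniq U -> all (leq 1) U ->
  \int[P]_w \prod_(u <- U) failure i u w = eps_avg ^+ \sum_(u <- U) (c u == i).
Proof.
move=> uU U0; pose pairs (V : seq nat) := [seq (i, u) | u <- V].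
have pairs_uniq V : uniq V -> uniq (pairs V) by move=> ?; rewrite map_inj_uniq// => ? ? [].
have pairs_gt0 V : all (leq 1) V -> all (fun p => 0 < p.2)%N (pairs V).
  by rewrite all_map.
set F := \bigcap_(p in [set` pairs U]) [set w | succ S p.1 p.2 w = false].
have mF : measurable F.
  by apply: fin_bigcap_measurable => // p _; exact: measurable_failure.
have -> : \int[P]_w \prod_(u <- U) failure i u w = fine (P F).
  rewrite -[F]setIT -integral_indic//; apply: eq_Rintegral => w _.
  rewrite indicE /F bigcap_seq; elim: (U) => [|u V IH]; first by rewrite !big_nil in_setT.
  rewrite /= !big_cons IH in_setI -mulnb natrM; congr (_ * _); congr (nat_of_bool _)%:R.
  by apply/idP/idP; rewrite inE /=; case: (succ S i u w).
(* The conditioning event is the whole space. *)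
have sigmaT : sigma_of_slots (effective_per (fun i t => per S i t) (sel S)) setT.
  have [m0 mC _] := smallest_sigma_algebra setT [set A | exists i t (B : set R),
    [/\ (0 < t)%N, measurable B &
        A = effective_per (fun i t => per S i t) (sel S) i t @^-1` B]].
  by rewrite -(setD0 setT); exact: mC.
have PF := @succ_law _ _ _ _ _ S setT _ (fun=> false) sigmaT (pairs_uniq U uU) (pairs_gt0 U U0).
rewrite -[F]setTI [fine _](congr1 fine PF) /=.
(* As the selection is non-random, the slots where [i] is unscheduled contribute the constant factor
   [1] and drop out. *)
have -> : fine (\int[P]_w (\prod_(p <- pairs U)
    effective_per (fun i t => per S i t) (sel S) p.1 p.2 w)%:E) =
    \int[P]_w \prod_(p <- pairs [seq u <- U | c u == i]) per S p.1 p.2 w.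
  apply: eq_Rintegral => w _; rewrite !big_map big_filter [RHS]big_mkcond big_seq [RHS]big_seq.
  apply: eq_bigr => -[|u] /(allP U0)// _.
  by rewrite /effective_per selc inE eq_sym.
rewrite (@Rintegral_prod_independent _ _ _ P _ (fun p => 0 < p.2)%N
  (fun p w => per S p.1 p.2 w)).
- rewrite big_map big_filter big_seq_cond (eq_bigr (fun=> eps_avg)).
    rewrite -big_seq_cond big_const_seq iter_mulr mulr1 -sum1_count big_mkcond/=.
    by congr (_ ^+ _); apply: eq_bigr => u _; case: eqP.
  by move=> u /andP[/(allP U0) u0 _]; exact: per_meanE.
- by move=> p _.
- by move=> p w; exact: per01.
- by move=> J B; exact: (per_iid S).2.
- exact/pairs_uniq/filter_uniq.
- by apply: pairs_gt0; apply/allP => u; rewrite mem_filter => /andP[_ /(allP U0)].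
Qed.

(** In terms of the failure indicator the recursion is affine: the new age is the old age times the
    indicator, plus [n]. Unrolling it gives the formula. *)
Lemma aoiE (n : R) h0 i t w : aoi n h0 i t w =
  h0 i * \prod_(1 <= u < t.+1) failure i u w +
  n * \sum_(1 <= a < t.+1) \prod_(a.+1 <= u < t.+1) failure i u w.
Proof.
elim: t => [|t IH]; first by rewrite /= !big_geq// mulr1 mulr0 addr0.
have -> : \sum_(1 <= a < t.+2) \prod_(a.+1 <= u < t.+2) failure i u w =
    (\sum_(1 <= a < t.+1) \prod_(a.+1 <= u < t.+1) failure i u w) * failure i t.+1 w + 1.
  rewrite big_nat_recr//= [\prod_(t.+2 <= u < t.+2) _]big_geq// mulr_suml; congr (_ + 1).
  by apply: eq_big_nat => a /andP[a0 at1]; rewrite big_nat_recr.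
rewrite [LHS]/= IH [\prod_(1 <= u < t.+2) _]big_nat_recr//=.
have -> : failure i t.+1 w = (~~ succ S i t.+1 w)%:R by [].
by case: (succ S i t.+1 w) => /=; ring.
Qed.

Lemma bounded_measurable_failures i (U : seq nat) :
  bounded_measurable (fun w => \prod_(u <- U) failure i u w).
Proof. by apply: bounded_measurable_prod => u _; exact: bounded_measurable_failure. Qed.

Lemma bounded_measurableZ (r : R) (f : sys_Omega S -> R) :
  bounded_measurable f -> bounded_measurable (fun w => r * f w).
Proof. by apply: bounded_measurableM; exact: bounded_measurable_cst. Qed.

Lemma bounded_measurable_aoi n h0 i t :
  bounded_measurable (fun w : sys_Omega S => aoi n h0 i t w).
Proof.
under eq_fun do rewrite aoiE.
apply: bounded_measurableD; apply: bounded_measurableZ.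
  exact: bounded_measurable_failures.
by apply: bounded_measurable_sum => a; exact: bounded_measurable_failures.
Qed.

Lemma Rintegral_aoi n h0 i t : \int[P]_w aoi n h0 i t w = mean_age eps_avg n h0 c i t.
Proof.
have bF := bounded_measurable_failures i.
have bS : bounded_measurable (fun w => \sum_(1 <= a < t.+1)
    \prod_(a.+1 <= u < t.+1) failure i u w).
  by apply: bounded_measurable_sum => a; exact: bF.
under eq_Rintegral do rewrite aoiE.
rewrite RintegralD//; [|exact/bounded_measurable_integrable/bounded_measurableZ..].
rewrite !RintegralZl//; [|exact: bounded_measurable_integrable..].
have positive a b : (0 < a)%N -> all (leq 1) (index_iota a b).
  by move=> a0; apply/allP => u; rewrite mem_index_iota => /andP[/(leq_trans a0)].
rewrite Rintegral_sum; last by move=> a; exact: bF.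
rewrite Rintegral_failures ?iota_uniq ?positive//; congr (_ * _ + _ * _).
by apply: eq_bigr => a _; rewrite Rintegral_failures ?iota_uniq ?positive.
Qed.

Lemma expectation_Rintegral (X : sys_Omega S -> R) : bounded_measurable X ->
  ('E_P[X] = (\int[P]_w X w)%:E)%E.
Proof.
move=> bX; rewrite unlock /Rintegral fineK//.
by apply: integrable_fin_num => //; exact: bounded_measurable_integrable.
Qed.

Lemma mean_aoiE n h0 t :
  (mean_aoi S n h0 t = (N%:R^-1 * \sum_(i < N) mean_age eps_avg n h0 c i t)%R%:E)%E.
Proof.
rewrite /mean_aoi EFinM -sumEFin; congr (_ * _)%E; apply: eq_bigr => i _.
by rewrite expectation_Rintegral ?Rintegral_aoi//; exact: bounded_measurable_aoi.
Qed.

Lemma time_avg_aoiE n h0 T : (time_avg_aoi S n h0 T =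
  ((N%:R * T%:R)^-1 * \sum_(1 <= t < T.+1) \sum_(i < N) mean_age eps_avg n h0 c i t)%R%:E)%E.
Proof.
have bI t : bounded_measurable (fun w : sys_Omega S => \sum_(i < N) aoi n h0 i t w).
  by apply: bounded_measurable_sum => i; exact: bounded_measurable_aoi.
have bS : bounded_measurable (fun w : sys_Omega S =>
    \sum_(1 <= t < T.+1) \sum_(i < N) aoi n h0 i t w).
  exact: bounded_measurable_sum.
rewrite /time_avg_aoi expectation_Rintegral; last exact: bounded_measurableZ.
rewrite RintegralZl//; last exact: bounded_measurable_integrable.
rewrite Rintegral_sum//; congr (_ * _)%:E; apply: eq_bigr => t _.
rewrite Rintegral_sum; last by move=> i; exact: bounded_measurable_aoi.
by apply: eq_bigr => i _; exact: Rintegral_aoi.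
Qed.

Lemma round_robin_balanced_attempts : round_robin S -> balanced c.
Proof.
move=> [_ rr]; have [w _] := sys_Omega_inhabited.
have idleE j t : idle_time j t w = (t - last_attempt c j t)%N.
  rewrite /idle_time /last_attempt; congr (_ - _)%N.
  rewrite big_nat_cond [RHS]big_nat_cond; apply: eq_bigl => -[|u]//.
  by rewrite selc inE eq_sym.
move=> a b i j; apply: round_robin_balanced => -[//|t] k _.
have := rr t.+1 w (c t.+1) k (ltn0Sn t); rewrite selc inE eqxx !idleE => /(_ isT).
(* Truncated subtraction reverses the order here because the last attempt of the selected UE
   precedes the slot. *)
by have := last_attempt_lt c (c t.+1) (ltn0Sn t); lia.
Qed.

End blind_systems.

Theorem theorem1 (R : realType) (N : nat) (law : probability R R) (eps_avg : R)
    (n : R) (hn : 0 < n) (h0 : 'I_N -> R) (hh0 : forall i, 0 <= h0 i)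
    (RR : system N 1 law eps_avg) (hRR : round_robin RR) :
  ((forall i j, h0 i = h0 j) ->
     forall pi : system N 1 law eps_avg, blind pi ->
     forall t : nat, (0 < t)%N ->
       (mean_aoi RR n h0 t <= mean_aoi pi n h0 t)%E) /\
  (forall pi : system N 1 law eps_avg, blind pi ->
     (limn_esup (fun T => time_avg_aoi RR n h0 T) <=
      limn_einf (fun T => time_avg_aoi pi n h0 T))%E).
Proof.
have [c cE] := blind_selection (proj1 hRR).
have bal := round_robin_balanced_attempts cE hRR.
have e01 := eps_avg01 RR c; have [e0 e1] := andP e01.
have N0 : (0 < N)%N by exact: leq_ltn_trans (ltn_ord (c 0%N)).
have NV0 : 0 <= N%:R^-1 :> R by rewrite invr_ge0.
split=> [h0E pi|pi] /blind_selection[c' c'E].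
  move=> t _; rewrite (mean_aoiE cE) (mean_aoiE c'E) lee_fin ler_wpM2l//.
  rewrite !sum_mean_age lerD//; last exact: fresh_age_le.
  (* The UE [c 0] only serves to name the common initial age, which factors out and leaves the power
     sum of one window. *)
  rewrite /initial_age (eq_bigr (fun i => h0 (c 0%N) * eps_avg ^+ attempts c i 1 t.+1)).
    rewrite [leRHS](eq_bigr (fun i => h0 (c 0%N) * eps_avg ^+ attempts c' i 1 t.+1)).
      by rewrite -!mulr_sumr ler_wpM2l//; exact: balanced_sum_le.
    by move=> i _; rewrite (h0E i (c 0%N)).
  by move=> i _; rewrite (h0E i (c 0%N)).
pose A := time_average (fun t => N%:R^-1 * fresh_age eps_avg n c t).
pose D := time_average (fun t => N%:R^-1 * initial_age eps_avg h0 c t).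
have avgE (S : system N 1 law eps_avg) c1 :
    (forall t w, sel S t.+1 w = [set c1 t.+1]%SET) -> forall T,
    time_avg_aoi S n h0 T =
    (time_average (fun t => N%:R^-1 * initial_age eps_avg h0 c1 t) T +
     time_average (fun t => N%:R^-1 * fresh_age eps_avg n c1 t) T)%:E.
  move=> c1E T; rewrite (time_avg_aoiE c1E) -time_averageD /time_average; congr EFin.
  rewrite invfM mulrC mulrA [RHS]mulrC; congr (_ * _).
  by rewrite mulr_suml; apply: eq_bigr => t _; rewrite sum_mean_age -mulrDr mulrC.
have ndA : nondecreasing_seq A.
  apply: time_average_nondecreasing => t; first by rewrite mulr_ge0// fresh_age_ge0.
  by rewrite ler_wpM2l// fresh_age_nondecreasing.
(* The limit is taken in the extended reals, since [A] may be unbounded. *)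
pose l := ereal_sup (range (EFin \o A)).
have Al : EFin \o A @ \oo --> l.
  by apply: ereal_nondecreasing_cvgn => a b ab; rewrite lee_fin ndA.
have lpi : (l <= limn_einf (fun T => time_avg_aoi pi n h0 T))%E.
  rewrite -(cvg_limn_einf_sup Al).1; apply: le_limn_einf => T.
  (* The initial part of [pi] is merely nonnegative; its fresh part dominates that of round-robin in
     every slot. *)
  rewrite (avgE pi c' c'E) lee_fin -[A T]add0r lerD//.
    apply: mulr_ge0; rewrite ?invr_ge0// sumr_ge0// => t _.
    by rewrite mulr_ge0// initial_age_ge0.
  by apply: time_average_le => t; rewrite ler_wpM2l// fresh_age_le.
apply: le_trans lpi.
(* If [eps_avg < 1], the initial part [D] vanishes in the limit, so the round-robin averages
   converge to [l]. *)
have [eps1|eps1] := ltrP eps_avg 1.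
  have D0 : D @ \oo --> (0 : R).
    apply: time_average_cvg; rewrite -[X in _ --> X](mulr0 N%:R^-1).
    by apply: cvgMr; exact: initial_age_cvg0.
  have : (fun T => time_avg_aoi RR n h0 T) @ \oo --> (0%:E + l)%E.
    under eq_fun do rewrite (avgE RR c cE) EFinD.
    apply: cvgeD => //.
    by apply: cvg_EFin D0; exact: nearW.
  by rewrite add0e => /cvg_limn_einf_sup[_ ->].
(* Here no transmission ever succeeds, and the ages grow without bound. *)
suff -> : l = +oo%E by rewrite leey.
have e_eq1 : eps_avg = 1 by apply/eqP; rewrite eq_le e1.
apply: eq_infty => r.
(* All powers are [1], so the fresh part per UE in slot [t] is [n] times [t]. *)
have AE T : A T = n * time_average (fun t => t%:R) T.
  rewrite /A /time_average mulrCA; congr (_ * _); rewrite mulr_sumr.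
  apply: eq_big_nat => t _; rewrite /fresh_age e_eq1 mulrCA; congr (_ * _).
  rewrite (eq_bigr (fun=> N%:R)) => [|a _].
    by rewrite sumr_const_nat subSS subn0 -(mulr_natr N%:R) mulKf// pnatr_eq0 -lt0n.
  by rewrite (eq_bigr (fun=> 1)) ?sumr_const ?card_ord// => i _; rewrite expr1n.
(* The average of the first [T] slot numbers is at least [T / 2], so [T] beyond [2 * r / n] lifts
   [A T] to [r]. *)
pose T := Num.bound `|2 * r / n|.
apply: (@le_trans _ _ (A T)%:E); last by apply: ereal_sup_ubound; exists T.
rewrite lee_fin AE.
have rT : 2 * r / n < T%:R by exact: le_lt_trans (ler_norm _) (archi_boundP (normr_ge0 _)).
apply: le_trans (ler_wpM2l (ltW hn) (time_average_id_ge R T)).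
by move: (ltW rT); rewrite ler_pdivrMr// [leRHS]mulrC; lra.
Qed.
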